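(* Let $n\ge 1$ be an integer and let $\mathcal{P}_n$ be the complex vector space of trigonometric polynomials $f(x)=\sum_{j=-n}^{n} p_j e^{ijx}$ ($x\in\mathbb{R}$, $p_j\in\mathbb{C}$) of degree at most $n$. Let $\Vert\cdot\Vert$ be a translation-invariant norm on $\mathcal{P}_n$. Then $$\Vert f'\Vert\le n\,\Vert f\Vert\qquad\text{for all } f\in\mathcal{P}_n .$$
   Context: For $a\in\mathbb{R}$, the translate $T_a f$ of a function $f$ on $\mathbb{R}$ is $T_a f(x)=f(x+a)$; the space $\mathcal{P}_n$ is invariant under all $T_a$. A norm $\Vert\cdot\Vert$ on $\mathcal{P}_n$ is translation-invariant if $\Vert T_a f\Vert=\Vert f\Vert$ for all $f\in\mathcal{P}_n$ and all $a\in\mathbb{R}$. Here $f'$ denotes the derivative of $f$ with respect to $x$. *)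

(* Defs.v *)
From Stdlib Require Import Reals ZArith.
From Coquelicot Require Export Coquelicot.
Open Scope R_scope.

(* e^{it} for real t; Coquelicot has no complex exponential. *)
Definition expi (t : R) : C := (cos t, sin t).

(* Membership in P_n.  The index k = 0, ..., 2n of [sum_n] (upper bound
   included) stands for j = k - n; values of p outside [-n, n] are unused. *)
Definition trig_poly (n : nat) (f : R -> C) : Prop :=
  exists p : Z -> C, forall x : R,
    f x = sum_n (fun k : nat =>
                   let j := (Z.of_nat k - Z.of_nat n)%Z in
                   Cmult (p j) (expi (IZR j * x))) (2 * n).

(* A norm on the complex vector space E of functions, with pointwise
   operations.  N is total on R -> C, but only its values on E are
   constrained. *)
Record is_norm_on (E : (R -> C) -> Prop) (N : (R -> C) -> R) : Prop := {
  norm_on_ge0 : forall f, E f -> 0 <= N f;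
  norm_on_eq0 : forall f, E f -> N f = 0 -> forall x, f x = RtoC 0;
  norm_on_scal : forall (c : C) f, E f ->
    N (fun x => Cmult c (f x)) = Cmod c * N f;
  norm_on_triangle : forall f g, E f -> E g ->
    N (fun x => Cplus (f x) (g x)) <= N f + N g
}.

Definition translate (a : R) (f : R -> C) : R -> C := fun x => f (x + a).

Definition translation_invariant_on
    (E : (R -> C) -> Prop) (N : (R -> C) -> R) : Prop :=
  forall f, E f -> forall a : R, N (translate a f) = N f.

(* f' is the derivative of f : R -> C, C being a normed space over R. *)
Definition is_derivative (f f' : R -> C) : Prop :=
  forall x : R,
    is_derive (K := R_AbsRing) (V := C_R_NormedModule) f x (f' x).

(* Main.v *)
(* M. Riesz's interpolation: with theta_r = (2r+1) pi / (2n), 0 <= r < 2n, and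
   positive weights d_r = 1 / (2n (1 - cos theta_r)), every f in P_n satisfies
     f'(x) = sum_r (-i d_r e^{i n theta_r}) f(x + theta_r),   sum_r d_r = n,
   and a translation-invariant norm turns this into the bound.  On
   exponentials the formula says that the moment A(m) = sum_r d_r e^{i m theta_r}
   equals n - m for 0 <= m <= 2n.  The second differences of A are geometric
   sums vanishing for 0 < m < 2n, so A is affine there; A(2n) = -A(0) and the
   second difference at 0 determine it. *)
Require Import Defs.
From Stdlib Require Import Reals Lra Lia FunctionalExtensionality.
From Coquelicot Require Import Coquelicot.
Open Scope R_scope.

(* Sums over [sum_n] leave equations at a projection type that [ring] does not
   recognise as [C]. *)
Ltac ring_C := match goal with |- @eq _ ?a ?b => change (@eq C a b) end; ring.

(** * Exponentials on the unit circle and geometric sums *)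

Lemma expi_plus (a b : R) : expi (a + b) = Cmult (expi a) (expi b).
Proof.
  unfold expi, Cmult; simpl; rewrite cos_plus, sin_plus; f_equal; ring.
Qed.

Lemma Copp_Cmult_l (a b : C) : Copp (Cmult a b) = Cmult (Copp a) b.
Proof. ring. Qed.

Lemma Cmod_expi (t : R) : Cmod (expi t) = 1.
Proof.
  unfold Cmod, expi; simpl fst; simpl snd.
  rewrite <- (sqrt_1); f_equal.
  generalize (sin2_cos2 t); unfold Rsqr; simpl; lra.
Qed.

Lemma expi_period_nat (t : R) (k : nat) : expi (t + 2 * INR k * PI) = expi t.
Proof.
  unfold expi; now rewrite cos_period, sin_period.
Qed.

Lemma cos_lt_1 (t : R) : 0 < t < 2 * PI -> cos t < 1.
Proof.
  intros Ht.
  replace t with (2 * (t / 2)) by field.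
  rewrite cos_2a_sin.
  assert (0 < sin (t / 2)) by (apply sin_gt_0; lra).
  nra.
Qed.

(** Geometric sum of ratio e^{it}, kept in product form; dividing is left to the place where e^{it}
    <> 1 is known. *)
Lemma sum_n_expi_telescope (a t : R) (k : nat) :
  Cmult (Cminus (expi t) (RtoC 1))
    (sum_n (fun r : nat => expi (a + INR r * t)) k)
  = Cminus (expi (a + INR (S k) * t)) (expi a).
Proof.
  induction k as [|k IH].
  - rewrite sum_O, S_INR; simpl INR.
    replace (a + (0 + 1) * t) with (a + t) by ring.
    replace (a + 0 * t) with a by ring.
    rewrite expi_plus; ring.
  - rewrite sum_Sn; change plus with Cplus.
    rewrite Cmult_plus_distr_l, IH, (S_INR (S k)).
    replace (a + (INR (S k) + 1) * t) with (a + INR (S k) * t + t) by ring.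
    rewrite (expi_plus (a + INR (S k) * t) t); ring.
Qed.

(** * Nodes, weights and moments of the interpolation formula *)

Definition riesz_node (n r : nat) : R := (2 * INR r + 1) * PI / (2 * INR n).

Definition riesz_weight (n r : nat) : R :=
  / (2 * INR n * (1 - cos (riesz_node n r))).

Definition riesz_moment (n m : nat) : C :=
  sum_n (fun r : nat => Cmult (RtoC (riesz_weight n r))
                          (expi (INR m * riesz_node n r))) (2 * n - 1).

Section Riesz.

Variable n : nat.
Hypothesis hn : (1 <= n)%nat.

Lemma INR_degree_pos : 0 < INR n.
Proof. apply lt_0_INR; lia. Qed.

(** From 1 <= 2r + 1 <= 4n - 1 the node lies strictly between 0 and 2 pi, so the denominator of
    [riesz_weight] is positive. *)
Lemma cos_riesz_node_lt_1 (r : nat) :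
  (r <= 2 * n - 1)%nat -> cos (riesz_node n r) < 1.
Proof.
  intros Hr; apply cos_lt_1; unfold riesz_node.
  pose proof INR_degree_pos as Hn; pose proof PI_RGT_0 as Hpi.
  pose proof (pos_INR r) as Hr0.
  assert (Hr1 : INR r + 1 <= 2 * INR n).
  { rewrite <- S_INR; change 2 with (INR 2); rewrite <- mult_INR.
    apply le_INR; lia. }
  split.
  - apply Rdiv_lt_0_compat; [apply Rmult_lt_0_compat|]; lra.
  - apply Rmult_lt_reg_r with (2 * INR n); [lra|].
    unfold Rdiv; rewrite Rmult_assoc, Rinv_l, Rmult_1_r by lra.
    nra.
Qed.

Lemma riesz_weight_pos (r : nat) :
  (r <= 2 * n - 1)%nat -> 0 < riesz_weight n r.
Proof.
  intros Hr; apply Rinv_0_lt_compat.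
  pose proof (cos_riesz_node_lt_1 r Hr); pose proof INR_degree_pos.
  apply Rmult_lt_0_compat; lra.
Qed.

(** The ratio e^{i m pi / n} is a 2n-th root of unity, different from 1 because 0 < m < 2n. *)
Lemma sum_n_expi_riesz_node (m : nat) :
  (1 <= m <= 2 * n - 1)%nat ->
  sum_n (fun r : nat => expi (INR m * riesz_node n r)) (2 * n - 1) = RtoC 0.
Proof.
  intros Hm.
  pose proof INR_degree_pos as Hn; pose proof PI_RGT_0 as Hpi.
  set (t := INR m * PI / INR n); set (a := INR m * PI / (2 * INR n)).
  assert (Hm1 : INR m < 2 * INR n).
  { change 2 with (INR 2); rewrite <- mult_INR; apply lt_INR; lia. }
  assert (Hm0 : 0 < INR m) by (apply lt_0_INR; lia).
  assert (Ht : 0 < t < 2 * PI).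
  { unfold t; split.
    - apply Rdiv_lt_0_compat; [apply Rmult_lt_0_compat|]; lra.
    - apply Rmult_lt_reg_r with (INR n); [lra|].
      unfold Rdiv; rewrite Rmult_assoc, Rinv_l, Rmult_1_r by lra; nra. }
  assert (Hne : Cminus (expi t) (RtoC 1) <> RtoC 0).
  { intros H; apply (f_equal fst) in H; simpl in H.
    pose proof (cos_lt_1 t Ht); lra. }
  rewrite (sum_n_ext _ (fun r : nat => expi (a + INR r * t))).
  2:{ intros r; f_equal; unfold riesz_node, a, t; field; lra. }
  pose proof (sum_n_expi_telescope a t (2 * n - 1)) as H.
  replace (S (2 * n - 1)) with (2 * n)%nat in H by lia.
  (* Since 2n t = 2 pi m, the two ends of the telescoped sum coincide. *)
  replace (a + INR (2 * n) * t) with (a + 2 * INR m * PI) in H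
    by (rewrite mult_INR; unfold t; simpl; field; lra).
  rewrite expi_period_nat in H.
  set (s := sum_n _ _) in *.
  replace s with (Cmult (Cinv (Cminus (expi t) (RtoC 1)))
                    (Cmult (Cminus (expi t) (RtoC 1)) s))
    by (field; exact Hne).
  rewrite H; ring_C.
Qed.

(** Factoring out e^{i(a+t)} leaves e^{it} - 2 + e^{-it} = 2 cos t - 2. *)
Lemma expi_second_difference (a t : R) :
  Cplus (Cminus (expi (a + 2 * t)) (Cmult (RtoC 2) (expi (a + t)))) (expi a)
  = Cmult (RtoC (-2 * (1 - cos t))) (expi (a + t)).
Proof.
  replace (a + 2 * t) with (a + t + t) by ring.
  replace a with (a + t + - t) at 3 by ring.
  rewrite (expi_plus (a + t) t), (expi_plus (a + t) (- t)).
  unfold expi, Cmult, Cminus, Cplus, Copp, RtoC; simpl.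
  rewrite cos_neg, sin_neg; f_equal; ring.
Qed.

(* The weights are chosen so that the factor [-2 (1 - cos theta_r)] of the
   second difference cancels, leaving a geometric sum. *)
Lemma riesz_moment_second_difference (m : nat) :
  Cplus (Cminus (riesz_moment n (S (S m)))
           (Cmult (RtoC 2) (riesz_moment n (S m)))) (riesz_moment n m)
  = Cmult (RtoC (- / INR n))
      (sum_n (fun r : nat => expi (INR (S m) * riesz_node n r)) (2 * n - 1)).
Proof.
  pose proof INR_degree_pos as Hn.
  unfold riesz_moment, Cminus.
  rewrite Copp_Cmult_l.
  rewrite <- !(sum_n_mult_l (K := C_Ring)), <- !(sum_n_plus (G := C_AbelianMonoid)).
  apply sum_n_ext_loc; intros r Hr.
  pose proof (cos_riesz_node_lt_1 r Hr) as Hc.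
  change plus with Cplus; change mult with Cmult.
  pose proof (expi_second_difference (INR m * riesz_node n r) (riesz_node n r)) as H.
  rewrite !S_INR.
  replace ((INR m + 1 + 1) * riesz_node n r)
    with (INR m * riesz_node n r + 2 * riesz_node n r) by ring.
  replace ((INR m + 1) * riesz_node n r)
    with (INR m * riesz_node n r + riesz_node n r) by ring.
  transitivity (Cmult (RtoC (riesz_weight n r))
     (Cmult (RtoC (-2 * (1 - cos (riesz_node n r))))
        (expi (INR m * riesz_node n r + riesz_node n r)))).
  { rewrite <- H; ring_C. }
  rewrite Cmult_assoc, <- RtoC_mult; f_equal; f_equal.
  unfold riesz_weight; field; lra.
Qed.

(** 2n theta_r = (2r + 1) pi is an odd multiple of pi. *)
Lemma expi_antiperiod_riesz_node (r : nat) (t : R) :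
  expi (INR (2 * n) * riesz_node n r + t) = Copp (expi t).
Proof.
  pose proof INR_degree_pos as Hn.
  replace (INR (2 * n) * riesz_node n r + t) with (t + PI + 2 * INR r * PI)
    by (rewrite mult_INR; unfold riesz_node; simpl; field; lra).
  rewrite expi_period_nat.
  unfold expi, Copp; simpl; now rewrite neg_cos, neg_sin.
Qed.

Lemma riesz_moment_last : riesz_moment n (2 * n) = Copp (riesz_moment n 0).
Proof.
  unfold riesz_moment.
  replace (Copp (sum_n _ _)) with
    (Cmult (RtoC (-1)) (riesz_moment n 0)) by (unfold riesz_moment; ring).
  unfold riesz_moment.
  rewrite <- (sum_n_mult_l (K := C_Ring)).
  apply sum_n_ext; intros r; change mult with Cmult.
  rewrite <- (Rplus_0_r (INR (2 * n) * _)), expi_antiperiod_riesz_node.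
  simpl INR; rewrite Rmult_0_l; ring_C.
Qed.

(* The second difference at 0: e^{2n i theta_r} = -1 turns the moment of
   index -1 into minus that of index 2n - 1. *)
Lemma riesz_moment_boundary :
  Cminus (Cminus (riesz_moment n 1) (Cmult (RtoC 2) (riesz_moment n 0)))
    (riesz_moment n (2 * n - 1)) = RtoC (-2).
Proof.
  pose proof INR_degree_pos as Hn.
  unfold riesz_moment, Cminus.
  rewrite Copp_Cmult_l.
  replace (Copp (sum_n _ _)) with
    (Cmult (RtoC (-1)) (riesz_moment n (2 * n - 1))) by (unfold riesz_moment; ring).
  unfold riesz_moment.
  rewrite <- !(sum_n_mult_l (K := C_Ring)), <- !(sum_n_plus (G := C_AbelianMonoid)).
  (* The weight cancels the factor -2 (1 - cos theta_r) and e^{i 0} = 1, so each of the 2n summands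
     equals -1/n. *)
  rewrite (sum_n_ext_loc _ (fun _ => RtoC (- / INR n))).
  - assert (Hc : forall k : nat,
      sum_n (fun _ : nat => RtoC (- / INR n)) k = RtoC (- INR (S k) / INR n)).
    { induction k as [|k IH].
      - rewrite sum_O; f_equal; simpl; field; lra.
      - rewrite sum_Sn, IH; change plus with Cplus; rewrite <- RtoC_plus.
        f_equal; rewrite (S_INR (S k)); field; lra. }
    rewrite Hc; f_equal.
    replace (S (2 * n - 1)) with (2 * n)%nat by lia.
    rewrite mult_INR; simpl; field; lra.
  - intros r Hr; pose proof (cos_riesz_node_lt_1 r Hr) as Hcos.
    change plus with Cplus; change mult with Cmult.
    replace (INR (2 * n - 1) * riesz_node n r)
      with (INR (2 * n) * riesz_node n r + - riesz_node n r)
      by (rewrite minus_INR by lia; simpl (INR 1); ring).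
    rewrite expi_antiperiod_riesz_node.
    simpl (INR 0); simpl (INR 1).
    pose proof (expi_second_difference (- riesz_node n r) (riesz_node n r)) as H.
    replace (- riesz_node n r + 2 * riesz_node n r) with (1 * riesz_node n r) in H
      by ring.
    replace (- riesz_node n r + riesz_node n r) with (0 * riesz_node n r) in H
      by ring.
    transitivity (Cmult (RtoC (riesz_weight n r))
     (Cmult (RtoC (-2 * (1 - cos (riesz_node n r)))) (expi (0 * riesz_node n r)))).
    { rewrite <- H; ring_C. }
    replace (expi (0 * riesz_node n r)) with (RtoC 1)
      by (unfold expi; rewrite Rmult_0_l, cos_0, sin_0; reflexivity).
    rewrite <- !RtoC_mult; f_equal.
    unfold riesz_weight; field; lra.
Qed.

(** The vanishing second difference is a two-term recurrence, so the induction carries two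
    consecutive moments. The bound on m keeps the middle index between 1 and 2n - 1. *)
Lemma riesz_moment_affine (m : nat) :
  (S m <= 2 * n)%nat ->
  let a := riesz_moment n 0 in
  let b := Cminus (riesz_moment n 1) a in
  riesz_moment n m = Cplus a (Cmult (RtoC (INR m)) b) /\
  riesz_moment n (S m) = Cplus a (Cmult (RtoC (INR (S m))) b).
Proof.
  intros Hm a b; induction m as [|m IH].
  - unfold b; simpl INR; fold a; split; ring.
  - destruct IH as [IH1 IH2]; [lia|]; split; [exact IH2|].
    pose proof (riesz_moment_second_difference m) as H.
    rewrite sum_n_expi_riesz_node in H by lia.
    replace (riesz_moment n (S (S m))) with
      (Cplus (Cplus (Cminus (riesz_moment n (S (S m)))
           (Cmult (RtoC 2) (riesz_moment n (S m)))) (riesz_moment n m))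
        (Cminus (Cmult (RtoC 2) (riesz_moment n (S m))) (riesz_moment n m)))
      by ring.
    rewrite H, IH1, IH2, !S_INR, !RtoC_plus; ring.
Qed.

Lemma riesz_momentE (m : nat) :
  (m <= 2 * n)%nat -> riesz_moment n m = RtoC (INR n - INR m).
Proof.
  pose proof INR_degree_pos as Hn.
  destruct (riesz_moment_affine (2 * n - 1)) as [H1 H2]; [lia|].
  pose proof riesz_moment_boundary as H3.
  replace (S (2 * n - 1)) with (2 * n)%nat in H2 by lia.
  rewrite riesz_moment_last in H2; rewrite H1 in H3.
  rewrite minus_INR in H3 by lia; rewrite mult_INR in H2, H3.
  simpl (INR 1) in H3; simpl (INR 2) in H2, H3.
  set (a := riesz_moment n 0) in *; set (d := Cminus (riesz_moment n 1) a) in *.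
  replace (riesz_moment n 1) with (Cplus a d) in H3 by (unfold d; ring).
  (* [H2] says -a = a + 2n d and [H3] says -2a - (2n - 2) d = -2. The first gives a = -n d, and then
     the second becomes 2d = -2. *)
  assert (Hab : a = RtoC (INR n) /\ d = RtoC (-1)).
  { clear H1; clearbody d; clearbody a.
    destruct a as [a1 a2], d as [d1 d2].
    injection H2; injection H3; intros; simpl in *.
    assert (d1 = -1) by nra; assert (d2 = 0) by nra.
    assert (a1 = INR n) by nra; assert (a2 = 0) by nra.
    subst; split; reflexivity. }
  destruct Hab as [Ha Hd].
  intros Hm.
  assert (H : riesz_moment n m = Cplus a (Cmult (RtoC (INR m)) d)).
  { destruct m as [|m].
    - simpl INR; fold a; ring.
    - exact (proj2 (riesz_moment_affine m Hm)). }
  rewrite H, Ha, Hd, <- RtoC_mult, <- RtoC_plus; f_equal; ring.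
Qed.

End Riesz.

(** * Derivatives of complex-valued functions of a real variable *)

Lemma is_derive_C_pair (u v : R -> R) (x a b : R) :
  is_derive u x a -> is_derive v x b ->
  is_derive (K := R_AbsRing) (V := C_R_NormedModule) (fun t => (u t, v t)) x (a, b).
Proof.
  intros Hu Hv.
  (* Writing (u, v) as u (1, 0) + v (0, 1) leaves a sum of real functions times fixed vectors. *)
  apply (is_derive_ext (V := C_R_NormedModule)
    (fun t => plus (scal (u t) ((1, 0) : C_R_NormedModule))
                   (scal (v t) ((0, 1) : C_R_NormedModule)))).
  { intros t; unfold scal, plus; simpl; unfold prod_scal, prod_plus, scal, plus;
    simpl; unfold mult, plus; simpl; f_equal; ring. }
  replace ((a, b) : C_R_NormedModule) with
    (plus (scal a ((1, 0) : C_R_NormedModule)) (scal b ((0, 1) : C_R_NormedModule))).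
  - apply (is_derive_plus (V := C_R_NormedModule));
      now apply (is_derive_scal_l (V := C_R_NormedModule)).
  - unfold scal, plus; simpl; unfold prod_scal, prod_plus, scal, plus;
    simpl; unfold mult, plus; simpl; f_equal; ring.
Qed.

Lemma is_derive_C_fst (f : R -> C) (x : R) (l : C) :
  is_derive (K := R_AbsRing) (V := C_R_NormedModule) f x l ->
  is_derive (fun t => fst (f t)) x (fst l).
Proof.
  intros H.
  apply (filterdiff_comp (U := R_NormedModule) (V := C_R_NormedModule)
    (W := R_NormedModule) f fst _ fst H).
  apply filterdiff_linear, is_linear_fst.
Qed.

Lemma is_derive_C_snd (f : R -> C) (x : R) (l : C) :
  is_derive (K := R_AbsRing) (V := C_R_NormedModule) f x l ->
  is_derive (fun t => snd (f t)) x (snd l).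
Proof.
  intros H.
  apply (filterdiff_comp (U := R_NormedModule) (V := C_R_NormedModule)
    (W := R_NormedModule) f snd _ snd H).
  apply filterdiff_linear, is_linear_snd.
Qed.

(** Both coordinates are linear maps, which reduces the claim to uniqueness of real derivatives. *)
Lemma is_derive_C_unique (f : R -> C) (x : R) (l1 l2 : C) :
  is_derive (K := R_AbsRing) (V := C_R_NormedModule) f x l1 ->
  is_derive (K := R_AbsRing) (V := C_R_NormedModule) f x l2 -> l1 = l2.
Proof.
  intros H1 H2; apply injective_projections.
  - rewrite <- (is_derive_unique _ _ _ (is_derive_C_fst _ _ _ H1)).
    exact (is_derive_unique _ _ _ (is_derive_C_fst _ _ _ H2)).
  - rewrite <- (is_derive_unique _ _ _ (is_derive_C_snd _ _ _ H1)).
    exact (is_derive_unique _ _ _ (is_derive_C_snd _ _ _ H2)).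
Qed.

Lemma is_derive_expi_scal (c : C) (w x : R) :
  is_derive (K := R_AbsRing) (V := C_R_NormedModule)
    (fun t => Cmult c (expi (w * t))) x
    (Cmult c (Cmult (Cmult Ci (RtoC w)) (expi (w * x)))).
Proof.
  destruct c as [c1 c2].
  (* The value i w c e^{iwx} is split into real and imaginary parts, to be differentiated
     separately. *)
  match goal with |- is_derive _ _ ?l =>
    replace l with
      (- c1 * w * sin (w * x) - c2 * w * cos (w * x),
       c1 * w * cos (w * x) - c2 * w * sin (w * x)) end.
  - unfold expi, Cmult; simpl.
    apply is_derive_C_pair; auto_derive; trivial; ring.
  - unfold expi, Cmult, Ci, RtoC; simpl; f_equal; ring.
Qed.

(** * Closure properties of P_n and the norm of a combination of translates *)

Section TrigPoly.

Variable n : nat.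

Lemma trig_poly_scal (c : C) (f : R -> C) :
  trig_poly n f -> trig_poly n (fun x => Cmult c (f x)).
Proof.
  intros [p Hp]; exists (fun j => Cmult c (p j)); intros x; rewrite Hp.
  rewrite <- (sum_n_mult_l (K := C_Ring)); apply sum_n_ext; intros k.
  change mult with Cmult; cbv zeta; ring_C.
Qed.

Lemma trig_poly_plus (f g : R -> C) :
  trig_poly n f -> trig_poly n g -> trig_poly n (fun x => Cplus (f x) (g x)).
Proof.
  intros [p Hp] [q Hq]; exists (fun j => Cplus (p j) (q j)); intros x.
  rewrite Hp, Hq, <- (sum_n_plus (G := C_AbelianMonoid)).
  apply sum_n_ext; intros k; change plus with Cplus; cbv zeta; ring_C.
Qed.

(** Translation by a multiplies the coefficient p_j by e^{ija}. *)
Lemma trig_poly_translate (a : R) (f : R -> C) :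
  trig_poly n f -> trig_poly n (translate a f).
Proof.
  intros [p Hp]; exists (fun j => Cmult (p j) (expi (IZR j * a))); intros x.
  unfold translate; rewrite Hp; apply sum_n_ext; intros k; cbv zeta.
  rewrite Rmult_plus_distr_l, expi_plus; ring_C.
Qed.

(** The triangle inequality is available only inside P_n, so the partial sums must be known to stay
    there. *)
Lemma trig_poly_sum_translate (c : nat -> C) (a : nat -> R) (f : R -> C) (k : nat) :
  trig_poly n f ->
  trig_poly n (fun x => sum_n (fun r => Cmult (c r) (f (x + a r))) k).
Proof.
  intros Hf; induction k as [|k IH].
  - replace (fun x => _) with (fun x => Cmult (c O) (translate (a O) f x)).
    + now apply trig_poly_scal, trig_poly_translate.
    + apply functional_extensionality; intros x; now rewrite sum_O.
  - replace (fun x => _) with (fun x =>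
      Cplus (sum_n (fun r => Cmult (c r) (f (x + a r))) k)
            (Cmult (c (S k)) (translate (a (S k)) f x))).
    + apply trig_poly_plus; [exact IH|].
      now apply trig_poly_scal, trig_poly_translate.
    + apply functional_extensionality; intros x; now rewrite sum_Sn.
Qed.

(** By homogeneity and invariance each term has norm |c_r| [N f]; the triangle inequality adds them
    up. *)
Lemma norm_sum_translate (N : (R -> C) -> R) (c : nat -> C) (a : nat -> R)
    (f : R -> C) (k : nat) :
  is_norm_on (trig_poly n) N -> translation_invariant_on (trig_poly n) N ->
  trig_poly n f ->
  N (fun x => sum_n (fun r => Cmult (c r) (f (x + a r))) k)
  <= sum_n (fun r => Cmod (c r)) k * N f.
Proof.
  intros hN hT Hf.
  assert (Hterm : forall r : nat,
    N (fun x => Cmult (c r) (translate (a r) f x)) = Cmod (c r) * N f).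
  { intros r; rewrite (norm_on_scal _ _ hN), (hT f Hf); trivial.
    now apply trig_poly_translate. }
  induction k as [|k IH].
  - rewrite sum_O, <- Hterm; apply Req_le; f_equal.
    apply functional_extensionality; intros x; now rewrite sum_O.
  - rewrite sum_Sn; change plus with Rplus; rewrite Rmult_plus_distr_r, <- Hterm.
    replace (fun x => sum_n _ (S k)) with (fun x =>
      Cplus (sum_n (fun r => Cmult (c r) (f (x + a r))) k)
            (Cmult (c (S k)) (translate (a (S k)) f x)))
      by (apply functional_extensionality; intros x; now rewrite sum_Sn).
    eapply Rle_trans; [apply (norm_on_triangle _ _ hN)|].
    + now apply trig_poly_sum_translate.
    + now apply trig_poly_scal, trig_poly_translate.
    + now apply Rplus_le_compat_r.
Qed.

End TrigPoly.

(** * The interpolation formula for the derivative and the resulting bound *)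

Definition riesz_coef (n r : nat) : C :=
  Cmult (Copp Ci) (Cmult (RtoC (riesz_weight n r)) (expi (INR n * riesz_node n r))).

(** The phase e^{i n theta_r} shifts the frequency j to k = j + n, so the sum is -i A(k) = -i (n -
    k) = ij, the factor by which differentiation acts on e^{ijx}. *)
Lemma riesz_coef_expi (n k : nat) :
  (1 <= n)%nat -> (k <= 2 * n)%nat ->
  let j := (Z.of_nat k - Z.of_nat n)%Z in
  sum_n (fun r => Cmult (riesz_coef n r) (expi (IZR j * riesz_node n r))) (2 * n - 1)
  = Cmult Ci (RtoC (IZR j)).
Proof.
  intros hn Hk j.
  assert (Hj : IZR j = INR k - INR n).
  { unfold j; now rewrite minus_IZR, <- !INR_IZR_INZ. }
  transitivity (Cmult (Copp Ci) (riesz_moment n k)).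
  - unfold riesz_moment; rewrite <- (sum_n_mult_l (K := C_Ring)).
    apply sum_n_ext; intros r; change mult with Cmult.
    replace (INR k * riesz_node n r) with (INR n * riesz_node n r + IZR j * riesz_node n r)
      by (rewrite Hj; ring).
    rewrite expi_plus; unfold riesz_coef; ring_C.
  - rewrite riesz_momentE by assumption.
    replace (INR n - INR k) with (- IZR j) by (rewrite Hj; ring).
    rewrite RtoC_opp; ring_C.
Qed.

(** Positivity of the weights makes |c_r| = d_r, and the sum of the weights is the moment A(0) =
    n. *)
Lemma sum_Cmod_riesz_coef (n : nat) :
  (1 <= n)%nat -> sum_n (fun r => Cmod (riesz_coef n r)) (2 * n - 1) = INR n.
Proof.
  intros hn.
  rewrite (sum_n_ext_loc _ (riesz_weight n)).
  - assert (H : forall k, sum_n (fun r => Cmult (RtoC (riesz_weight n r))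
                            (expi (INR 0 * riesz_node n r))) k
                = RtoC (sum_n (riesz_weight n) k)).
    { assert (H0 : forall t, expi (INR 0 * t) = RtoC 1).
      { intros t; unfold expi; simpl INR; now rewrite Rmult_0_l, cos_0, sin_0. }
      induction k as [|k IH].
      - rewrite !sum_O, H0; ring_C.
      - rewrite !sum_Sn, IH, H0; change plus with Cplus at 1.
        rewrite Cmult_1_r, <- RtoC_plus; reflexivity. }
    pose proof (riesz_momentE n hn 0 ltac:(lia)) as H1.
    unfold riesz_moment in H1; rewrite H in H1.
    apply RtoC_inj in H1; rewrite H1; simpl; ring.
  - intros r Hr; unfold riesz_coef.
    rewrite !Cmod_mult, Cmod_opp, Cmod_expi, Cmod_R.
    rewrite Cmod_Ci, Rabs_pos_eq; [now rewrite Rmult_1_l, Rmult_1_r|].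
    now apply Rlt_le, riesz_weight_pos.
Qed.

Lemma riesz_interpolation (n : nat) (f : R -> C) :
  (1 <= n)%nat -> trig_poly n f ->
  is_derivative f (fun x =>
    sum_n (fun r => Cmult (riesz_coef n r) (f (x + riesz_node n r))) (2 * n - 1)).
Proof.
  intros hn [p Hp] x.
  apply (is_derive_ext (V := C_R_NormedModule)
    (fun y => sum_n (fun k => Cmult (p (Z.of_nat k - Z.of_nat n)%Z)
         (expi (IZR (Z.of_nat k - Z.of_nat n) * y)) : C_R_NormedModule) (2 * n))).
  { intros t; now rewrite Hp. }
  replace (sum_n _ (2 * n - 1)) with
    (sum_n (fun k => let j := (Z.of_nat k - Z.of_nat n)%Z in
       Cmult (p j) (Cmult (Cmult Ci (RtoC (IZR j))) (expi (IZR j * x))))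
      (2 * n)).
  - apply (is_derive_sum_n (V := C_R_NormedModule)); intros k _.
    apply is_derive_expi_scal.
  (* Expanding f at the nodes gives a double sum over nodes and frequencies; exchanging the sums
     isolates, for each j, the inner sum equal to ij. *)
  - transitivity (sum_n (fun r => sum_n (fun k =>
      let j := (Z.of_nat k - Z.of_nat n)%Z in
      Cmult (Cmult (p j) (expi (IZR j * x)))
        (Cmult (riesz_coef n r) (expi (IZR j * riesz_node n r)))) (2 * n)) (2 * n - 1)).
    + rewrite sum_n_switch; apply sum_n_ext_loc; intros k Hk; cbv zeta.
      set (j := (Z.of_nat k - Z.of_nat n)%Z).
      transitivity (Cmult (Cmult (p j) (expi (IZR j * x))) (Cmult Ci (RtoC (IZR j)))).
      * ring_C.
      * unfold j; rewrite <- (riesz_coef_expi n k hn Hk).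
        symmetry; apply (sum_n_mult_l (K := C_Ring)).
    + apply sum_n_ext; intros r.
      rewrite Hp, <- (sum_n_mult_l (K := C_Ring)); apply sum_n_ext; intros k.
      change mult with Cmult; cbv zeta.
      rewrite Rmult_plus_distr_l, expi_plus; ring_C.
Qed.

Theorem theorem2p4 (n : nat) (hn : (1 <= n)%nat) (N : (R -> C) -> R)
    (hN : is_norm_on (trig_poly n) N)
    (hT : translation_invariant_on (trig_poly n) N) :
  forall f f' : R -> C, trig_poly n f -> is_derivative f f' ->
    N f' <= INR n * N f.
Proof.
  intros f f' Hf Hf'.
  (* Uniqueness of the derivative identifies [f'] with the interpolation sum as a function, so [N]
     can be evaluated on that sum. *)
  rewrite (functional_extensionality f' _ (fun x =>
    is_derive_C_unique f x _ _ (Hf' x) (riesz_interpolation n f hn Hf x))).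
  rewrite <- (sum_Cmod_riesz_coef n hn).
  now apply (norm_sum_translate n).
Qed.
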